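(* Let $X$ be a non-trivial real Banach space and let $\delta>0$. The following assertions are equivalent: (i) $X$ is weakly $\delta$-average rough; (ii) whenever $n\in\mathbb{N}$, $x_1,\dots,x_n\in S_X$, $x^\ast\in B_{X^\ast}$, and $\varepsilon,t_0>0$, there is a $y\in S_X$ such that \[\inf_{\substack{i\in\{1,\dots,n\}\\ t\geq t_0}}\frac{\|x_i+ty\|-x^\ast(x_i)}{t}-\sup_{\substack{i\in\{1,\dots,n\}\\ t\geq t_0}}\frac{\|x_i-ty\|-x^\ast(x_i)}{-t}>\delta-\varepsilon;\] (iii) whenever $E$ is a non-trivial finite-dimensional subspace of $X$, $x^\ast\in B_{X^\ast}$, and $\varepsilon,t_0>0$, there is a $y\in S_X$ such that \[\inf_{\substack{x\in S_E\\ t\geq t_0}}\frac{\|x+ty\|-x^\ast(x)}{t}-\sup_{\substack{x\in S_E\\ t\geq t_0}}\frac{\|x-ty\|-x^\ast(x)}{-t}>\delta-\varepsilon;\] (iv) whenever $E$ is a non-trivial finite-dimensional subspace of $X$, $x^\ast\in B_{X^\ast}$, and $\varepsilon>0$, there are $x_1^\ast,x_2^\ast\in X^\ast$ with $\|x_1^\ast\|,\|x_2^\ast\|\leq 1+\varepsilon$, and $y\in S_X$ satisfying \[x_1^\ast|_E=x_2^\ast|_E=x^\ast|_E\quad\text{and}\quad x_1^\ast(y)-x_2^\ast(y)>\delta-\varepsilon;\] (v) whenever $n\in\mathbb{N}$, $x_1,\dots,x_n\in S_X$, $x^\ast\in S_{X^\ast}$, and $\varepsilon>0$, there are $x_1^\ast,x_2^\ast\in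 B_{X^\ast}$ and $y\in B_X$ satisfying \[|x_j^\ast(x_i)-x^\ast(x_i)|<\varepsilon\quad\text{for all } i\in\{1,\dots,n\}\text{ and } j\in\{1,2\},\] and $x_1^\ast(y)-x_2^\ast(y)>\delta-\varepsilon$.
   Context: $B_Z$ and $S_Z$ denote the closed unit ball and the unit sphere of a normed space $Z$; $X^\ast$ is the dual of $X$. For $\delta>0$, a Banach space $X$ is weakly $\delta$-average rough if every non-empty relatively weak$^\ast$ open subset of $B_{X^\ast}$ has (norm) diameter greater than or equal to $\delta$. *)

(* Defs.v *)
From HB Require Import structures.
From mathcomp Require Import all_boot all_order all_algebra.
From mathcomp Require Import all_classical all_reals all_analysis.

Set Implicit Arguments.
Unset Strict Implicit.
Unset Printing Implicit Defensive.

Import Order.TTheory GRing.Theory Num.Theory.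
Import numFieldNormedType.Exports.

Local Open Scope classical_set_scope.
Local Open Scope ring_scope.

Definition unit_ball (R : realType) (Z : normedModType R) : set Z :=
  [set z | `|z| <= 1].

Definition unit_sphere (R : realType) (Z : normedModType R) : set Z :=
  [set z | `|z| = 1].

Arguments unit_ball {R} Z.
Arguments unit_sphere {R} Z.

Section Dual.
Variables (R : realType) (X : normedModType R).

Definition continuous_functional : {pred X -> R^o} :=
  mem [set f : X -> R^o | linear f /\ continuous f].

Record dual := Dual {
  dual_fun :> X -> R^o;
  dual_funP : dual_fun \in continuous_functional
}.

HB.instance Definition _ := [isSub for dual_fun].
HB.instance Definition _ := [Choice of dual by <:].

Lemma continuous_functional_submod_closed :
  submod_closed continuous_functional.
Proof.
split.
  apply/mem_set; split => [a u v|]; first by rewrite scaler0 addr0.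
  exact: cst_continuous.
move=> a f g /set_mem[lf cf] /set_mem[lg cg]; apply/mem_set; split.
  move=> b u v; rewrite /= !fctE lf lg !scalerDr !scalerA (mulrC b a).
  by rewrite -!addrA; congr (_ + _); rewrite addrCA.
move=> x; apply: continuousD; last exact: cg.
by apply: continuousZl_tmp; exact: cf.
Qed.

HB.instance Definition _ := GRing.isSubmodClosed.Build _ _
  continuous_functional continuous_functional_submod_closed.
HB.instance Definition _ := [SubChoice_isSubLmodule of dual by <:].

Definition dual_norm (f : dual) : R := sup [set `|f x| | x in unit_ball X].

Lemma dual_linear (f : dual) : linear f.
Proof. by case: f => f /= /set_mem[]. Qed.

Lemma dual_continuous (f : dual) : continuous f.
Proof. by case: f => f /= /set_mem[]. Qed.

HB.instance Definition _ (f : dual) :=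
  GRing.isLinear.Build R X R^o *:%R f (dual_linear f).

Lemma dual_norm_has_sup (f : dual) : has_sup [set `|f x| | x in unit_ball X].
Proof.
split; first by exists `|f 0|, 0 => //; rewrite /unit_ball /= normr0.
have /bounded_funP/(_ 1)[M fM] :=
  (linear_bounded_continuous f).2 (@dual_continuous f).
by exists M => _ [x x1 <-]; exact: fM.
Qed.

Lemma dual_norm_ge0 (f : dual) : 0 <= dual_norm f.
Proof.
apply: (le_trans (normr_ge0 (f 0))); apply: ub_le_sup.
  by case: (dual_norm_has_sup f).
by exists 0 => //; rewrite /unit_ball /= normr0.
Qed.

Lemma ler_dual_norm (f : dual) x : `|f x| <= dual_norm f * `|x|.
Proof.
have [->|x0] := eqVneq x 0; first by rewrite linear0 !normr0 mulr0.
rewrite -ler_pdivrMr ?normr_gt0// mulrC.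
apply: ub_le_sup; first by case: (dual_norm_has_sup f).
exists (`|x|^-1 *: x).
  by rewrite /unit_ball /= normrZ normfV normr_id mulVf// normr_eq0.
by rewrite linearZ /= normrZ normfV normr_id.
Qed.

Lemma dual_norm_le (f : dual) (M : R) :
  (forall x, `|x| <= 1 -> `|f x| <= M) -> dual_norm f <= M.
Proof.
move=> fM; apply: ge_sup; first by case: (dual_norm_has_sup f).
by move=> _ [x x1 <-]; exact: fM.
Qed.

Lemma ler_dual_normD (f g : dual) :
  dual_norm (f + g) <= dual_norm f + dual_norm g.
Proof.
apply: dual_norm_le => x x1; apply: (le_trans (ler_normD _ _)).
by apply: lerD; apply: (le_trans (ler_dual_norm _ _));
  rewrite ler_piMr// dual_norm_ge0.
Qed.

Lemma dual_normZ (a : R) (f : dual) :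
  dual_norm (a *: f) = `|a| * dual_norm f.
Proof.
have le b g : dual_norm (b *: g) <= `|b| * dual_norm g.
  apply: dual_norm_le => x x1; rewrite [leLHS]normrZ ler_wpM2l//.
  by apply: (le_trans (ler_dual_norm _ _)); rewrite ler_piMr// dual_norm_ge0.
apply/eqP; rewrite eq_le le /=.
have [->|a0] := eqVneq a 0; first by rewrite normr0 mul0r dual_norm_ge0.
rewrite -ler_pdivlMl ?normr_gt0// -normfV (le_trans _ (le _ _))//.
by rewrite scalerA mulVf// scale1r.
Qed.

Lemma dual_norm_eq0 (f : dual) : dual_norm f = 0 -> f = 0.
Proof.
move=> f0; apply/val_inj/funext => x; apply/eqP; rewrite -normr_le0.
by apply: (le_trans (ler_dual_norm f x)); rewrite f0 mul0r.
Qed.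

HB.instance Definition _ := Lmodule_isNormed.Build R dual
  ler_dual_normD dual_normZ dual_norm_eq0.

End Dual.

Arguments dual {R} X.

(* As [initial_topology] is an alias of its domain, [open (U : set weak_star X)]
   and [open U] refer to the weak* and to the norm topology respectively. *)
Definition weak_star (R : realType) (X : normedModType R) : Type :=
  initial_topology (fun f : dual X => (f : {ptws X -> R^o})).

HB.instance Definition _ (R : realType) (X : normedModType R) :=
  Topological.on (weak_star X).

Definition weak_star_relatively_open (R : realType) (X : normedModType R)
    (B A : set (dual X)) : Prop :=
  exists2 U : set (weak_star X), open U & A = U `&` B.

Definition diameter (R : realType) (Z : normedModType R) (A : set Z) : \bar R :=
  ereal_sup [set `|z.1 - z.2|%:E | z in A `*` A].

Definition weakly_average_rough (R : realType) (X : normedModType R)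
    (delta : R) : Prop :=
  forall A : set (dual X), weak_star_relatively_open (unit_ball (dual X)) A ->
    A !=set0 -> (delta%:E <= diameter A)%E.

Arguments weakly_average_rough {R} X delta.

Definition linear_subspace (R : realType) (X : normedModType R)
    (E : set X) : Prop := submod_closed (mem E).

Definition finite_dimensional (R : realType) (X : normedModType R)
    (E : set X) : Prop :=
  exists (m : nat) (e : 'I_m -> X), (forall i, E (e i)) /\
    forall x, E x -> exists a : 'I_m -> R, x = \sum_i a i *: e i.

Definition nontrivial (R : realType) (X : normedModType R) (E : set X) : Prop :=
  exists2 x, E x & x != 0.

(* Main.v *)
(**
  Roughness says that every weak* neighbourhood of a functional of the unit ball
  contains two functionals f1, f2 of the ball with f1 y - f2 y almost delta at a
  unit vector y.  Testing x + t y with f1 and x - t y with f2 gives the slope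
  estimates; they pass from finitely many points to the sphere of a
  finite-dimensional E through a finite net.  Conversely, if a is the infimum of
  the slopes (|x + t y| - x*(x)) / t over t >= t0, then x*(x) + t a <= (1 + e) |x + t y|
  for all x in E and t >= 0: by the definition of a when t >= t0 |x|, and because
  x dominates when t is smaller, t0 being small.  The Hahn-Banach theorem then yields
  an extension of x* from E with norm at most 1 + e and value at least a at y;
  the same with -y yields the second extension.  Since (v) only concerns functionals
  of norm one, a functional of the ball is first pushed to the sphere along a
  difference of two functionals provided by (v) itself, which barely changes its
  values at the given points.
*)

Require Import Defs.
From HB Require Import structures.
From mathcomp Require Import all_boot all_order all_algebra.
From mathcomp Require Import all_classical all_reals all_analysis.
From mathcomp Require Import ring lra.

Set Implicit Arguments.
Unset Strict Implicit.
Unset Printing Implicit Defensive.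

Import Order.TTheory GRing.Theory Num.Theory.
Import numFieldNormedType.Exports.

Local Open Scope classical_set_scope.
Local Open Scope ring_scope.

(** * The Hahn-Banach theorem for sublinear functionals *)

Section HahnBanach.
Variables (R : realType) (V : lmodType R).
Implicit Types (p q : V -> R).

Definition sublinear p := forall (s t : R) (x y : V), 0 <= s -> 0 <= t ->
  p (s *: x + t *: y) <= s * p x + t * p y.

Lemma sublinearD p x y : sublinear p -> p (x + y) <= p x + p y.
Proof. by move=> /(_ 1 1 x y ler01 ler01); rewrite !scale1r !mul1r. Qed.

Lemma sublinear0 p : sublinear p -> p 0 = 0.
Proof.
move=> pl; apply/eqP; rewrite eq_le; apply/andP; split.
  by have := pl 0 0 0 0 (lexx 0) (lexx 0); rewrite !scale0r addr0 !mul0r addr0.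
by have := sublinearD 0 0 pl; rewrite addr0 lerDl.
Qed.

Lemma sublinearZ p t x : sublinear p -> 0 <= t -> p (t *: x) = t * p x.
Proof.
move=> pl t0; have le s z : 0 <= s -> p (s *: z) <= s * p z.
  by move=> s0; have := pl s 0 z 0 s0 (lexx 0); rewrite scaler0 addr0 mul0r addr0.
apply/eqP; rewrite eq_le le//=; have [->|tn0] := eqVneq t 0.
  by rewrite scale0r sublinear0// mul0r.
have tp : 0 < t by rewrite lt_def tn0.
by rewrite -ler_pdivlMl// (le_trans _ (le _ _ _)) ?invr_ge0// scalerA mulVf// scale1r.
Qed.

Lemma sublinear_opp_le p x : sublinear p -> - p (- x) <= p x.
Proof.
move=> pl; have := sublinearD x (- x) pl.
by rewrite subrr sublinear0// -lerBlDr sub0r.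
Qed.

Lemma inf_affine_ge (A : set R) (s c d : R) : A !=set0 -> 0 <= s ->
  (forall a, A a -> c <= s * a + d) -> c <= s * inf A + d.
Proof.
move=> A0; rewrite le_eqVlt => /orP[/eqP<-|s0] cA.
  by have [a /cA] := A0; rewrite !mul0r.
rewrite -lerBlDr -ler_pdivrMl//; apply: lb_le_inf => // a /cA.
by rewrite ler_pdivrMl// lerBlDr.
Qed.

(** Since one index [l] serves any two given indices, the two infima on the right can be taken one
    after the other. Minimality, chains in Zorn's lemma and the majorant in [dual_extension] all
    rest on this. *)
Lemma sublinear_inf (I : Type) (J : set I) (g : I -> V -> R) :
  J !=set0 -> (forall x, has_lbound [set g j x | j in J]) ->
  (forall s t x y j k, 0 <= s -> 0 <= t -> J j -> J k ->
    exists2 l, J l & g l (s *: x + t *: y) <= s * g j x + t * g k y) ->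
  sublinear (fun x => inf [set g j x | j in J]).
Proof.
move=> [j0 Jj0] lb dir s t x y s0 t0 /=.
apply: (@inf_affine_ge [set g j x | j in J]) => //; first by exists (g j0 x), j0.
move=> _ [j Jj <-]; rewrite [leRHS]addrC.
apply: (@inf_affine_ge [set g j y | j in J]) => //; first by exists (g j0 y), j0.
move=> _ [k Jk <-]; have [l Jl gl] := dir s t x y j k s0 t0 Jj Jk.
rewrite [leRHS]addrC; apply: le_trans gl; apply: ge_inf => //.
by exists l.
Qed.

(** For fixed [v], the infimum over [t >= 0] of [q (z + t *: v) - t * q v] is sublinear in [z] and,
    by [t = 0], lies below [q]. Minimality makes it equal to [q], and [t = 1] gives the missing
    inequality. *)
Lemma minimal_sublinear_additive q : sublinear q ->
    (forall q', sublinear q' -> (forall x, q' x <= q x) -> q' = q) ->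
  forall x y, q (x + y) = q x + q y.
Proof.
move=> ql qmin x v; apply/eqP; rewrite eq_le sublinearD//=.
pose g (t : R) z := q (z + t *: v) - t * q v.
pose J := [set t : R | 0 <= t].
have lb z : has_lbound [set g t z | t in J].
  exists (- q (- z)) => _ [t t0 <-]; rewrite /g lerBrDr -sublinearZ// addrC.
  rewrite lerBlDr -{1}[t *: v](addrK z) [_ + z]addrC; exact: sublinearD.
have J0 : J 0 by rewrite /J /=.
have g'l : sublinear (fun z => inf [set g t z | t in J]).
  apply: sublinear_inf => //; first by exists 0.
  move=> s t z w a b s0 t0 a0 b0; exists (s * a + t * b).
    by rewrite /J /= addr_ge0// mulr_ge0.
  rewrite /g; have := ql s t (z + a *: v) (w + b *: v) s0 t0.
  rewrite !scalerDr !scalerA addrACA -scalerDl; nra.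
have g'q : (fun z => inf [set g t z | t in J]) = q.
  apply: qmin => // z; apply: ge_inf => //; exists 0 => //.
  by rewrite /g scale0r mul0r addr0 subr0.
rewrite -lerBrDr -[q x](congr1 (@^~ x) g'q) /=.
apply: ge_inf => //; exists 1; first exact: ler01.
by rewrite /g scale1r mul1r.
Qed.

Lemma sublinear_linear q : sublinear q -> (forall x y, q (x + y) = q x + q y) ->
  linear (q : V -> R^o).
Proof.
move=> ql qD a x y; rewrite qD; congr (_ + _).
have qN z : q (- z) = - q z.
  by apply/eqP; rewrite -addr_eq0 addrC -qD subrr sublinear0.
have [a0|/ltW a0] := leP 0 a; first exact: sublinearZ.
by rewrite -{1}[a]opprK scaleNr qN sublinearZ ?oppr_ge0// mulNr opprK.
Qed.

(* A minimal sublinear functional is linear, and Zorn's lemma gives one below p. *)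
Theorem hahn_banach p : sublinear p ->
  exists2 f : V -> R^o, linear f & forall x, f x <= p x.
Proof.
move=> pl; pose T := {q : V -> R | sublinear q /\ forall x, q x <= p x}.
(* The order is reversed, so that a maximal element for Zorn's lemma is a minimal functional. *)
pose ge (q q' : T) := `[< forall x, sval q' x <= sval q x >].
have [| | | |[q [ql qp]] qmin] := @Zorn T ge.
- by move=> q; apply/asboolP => x.
- by move=> r s t /asboolP rs /asboolP st; apply/asboolP => x; exact: le_trans (rs x).
- move=> [r Pr] [s Ps] /asboolP/= rs /asboolP/= sr; apply: eq_exist.
  by apply/funext => x; apply/eqP; rewrite eq_le rs sr.
- move=> A Atot; have [->|/set0P A0] := eqVneq A set0.
    by exists (exist _ p (conj pl (fun=> lexx _))).
  have lb x : has_lbound [set (sval q : V -> R) x | q in A].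
    exists (- p (- x)) => _ [[q [ql qp]] Aq <-] /=.
    by apply: le_trans (sublinear_opp_le x ql); rewrite lerN2.
  have infl : sublinear (fun x => inf [set (sval q : V -> R) x | q in A]).
    apply: sublinear_inf => // s t x y q r s0 t0 Aq Ar.
    have [/asboolP qr|/asboolP rq] := Atot _ _ Aq Ar.
      exists r => //; apply: le_trans (proj1 (svalP r) _ _ _ _ s0 t0) _.
      by rewrite lerD2r ler_wpM2l.
    exists q => //; apply: le_trans (proj1 (svalP q) _ _ _ _ s0 t0) _.
    by rewrite lerD2l ler_wpM2l.
  have infp x : inf [set (sval q : V -> R) x | q in A] <= p x.
    have [q Aq] := A0; apply: le_trans (proj2 (svalP q) x).
    by apply: ge_inf => //; exists q.
  pose infq : T := exist _ (fun x => inf [set (sval q : V -> R) x | q in A])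
    (conj infl infp).
  exists infq => q Aq; apply/asboolP => x /=.
  by apply: ge_inf => //; exists q.
exists q => //; apply: sublinear_linear => //.
apply: minimal_sublinear_additive => // q' q'l q'q.
have q'p x : q' x <= p x by apply: le_trans (qp x).
by have /(congr1 sval) := qmin (exist _ q' (conj q'l q'p)) (introT (asboolP _) q'q).
Qed.

End HahnBanach.

(** * Extensions of functionals and the weak* topology *)

Section DualSpace.
Variables (R : realType) (X : normedModType R).
Implicit Types (f xs : dual X) (E : set X) (x y : X).

Lemma ler_dual f x : f x <= `|f| * `|x|.
Proof. exact: le_trans (ler_norm _) (ler_dual_norm f x). Qed.

Lemma ler_unit_ball f x : unit_ball (dual X) f -> f x <= `|x|.
Proof. by move=> f1; apply: le_trans (ler_dual f x) _; rewrite ler_piMl. Qed.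

Lemma dual_subE f1 f2 x : (f1 - f2) x = f1 x - f2 x.
Proof. by []. Qed.

Lemma dual_of_linear (f : X -> R^o) (M : R) : linear f -> 0 <= M ->
  (forall x, f x <= M * `|x|) -> exists2 g : dual X, `|g| <= M & g =1 f.
Proof.
move=> fl M0 fM.
pose lf : {linear X -> R^o} := HB.pack f (GRing.isLinear.Build R X R^o *:%R f fl).
have normf x : `|f x| <= M * `|x|.
  rewrite ler_norml fM andbT lerNl -[X in _ <= _ * X]normrN.
  by apply: le_trans (fM (- x)); rewrite -[f]/(lf : X -> R^o) linearN.
have cf : continuous f.
  rewrite -[f]/(lf : X -> R^o); apply/linear_bounded_continuous/bounded_funP => r.
  exists (M * r) => x xr; apply: le_trans (normf x) _.
  by rewrite ler_wpM2l.
exists (Dual (mem_set (conj fl cf))) => //.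
by apply: dual_norm_le => x x1; apply: le_trans (normf x) _; rewrite ler_piMr.
Qed.

Lemma linear_subspaceD E a b x y : linear_subspace E -> E x -> E y ->
  E (a *: x + b *: y).
Proof.
move=> [E0 lin] Ex Ey; apply/set_mem; apply: (lin); first exact: mem_set.
by rewrite -[_ *: _]addr0; apply: lin; [exact: mem_set|].
Qed.

(** Hahn-Banach is applied to the infimum of [g (x, t) z] over [x] in [E] and [t >= 0]. The pair
    [(0, 0)] bounds the norm by [M], the pairs [(x, 0)] at [z = x] force agreement with [xs] on [E],
    and [(0, 1)] at [z = - y] gives [a <= f y]. *)
Lemma dual_extension E xs y (a M : R) : linear_subspace E -> 0 <= M ->
    (forall x t, E x -> 0 <= t -> xs x + t * a <= M * `|x + t *: y|) ->
  exists f, [/\ `|f| <= M, forall x, E x -> f x = xs x & a <= f y].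
Proof.
move=> Esub M0 dom.
have E0 : E 0 by apply/set_mem; case: Esub.
have EN x : E x -> E (- x).
  by move=> Ex; rewrite -[- x]addr0 -scaleN1r -[0](scale0r x); exact: linear_subspaceD.
pose g (j : X * R) z := M * `|z + j.2 *: y - j.1| + xs j.1 - j.2 * a.
pose J := [set j : X * R | E j.1 /\ 0 <= j.2].
have J0 : J (0, 0) by split.
have lb z : has_lbound [set g j z | j in J].
  (* The domination hypothesis, taken at [- x], is what keeps the infimum finite. *)
  exists (- (M * `|z|)) => _ [[x t] [/= Ex t0] <-]; rewrite /g /=.
  have := dom (- x) t (EN _ Ex) t0; rewrite linearN /=.
  have : `|- x + t *: y| <= `|z + t *: y - x| + `|z|.
    suff {1}-> : - x + t *: y = z + t *: y - x - z by exact: ler_normB.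
    by rewrite [RHS]addrC -[z + _ - x]addrA addKr addrC.
  by move=> /(ler_wpM2l M0); rewrite mulrDr; lra.
have pl : sublinear (fun z => inf [set g j z | j in J]).
  apply: sublinear_inf => //; first by exists (0, 0).
  move=> s t z w [x b] [x' b'] s0 t0 [/= Ex b0] [/= Ex' b'0].
  exists (s *: x + t *: x', s * b + t * b').
    by split => /=; [exact: linear_subspaceD|rewrite addr_ge0 ?mulr_ge0].
  have xsl : xs (s *: x + t *: x') = s * xs x + t * xs x'.
    by rewrite linearD !linearZ.
  rewrite /g /= xsl.
  have -> : s *: z + t *: w + (s * b + t * b') *: y - (s *: x + t *: x') =
    s *: (z + b *: y - x) + t *: (w + b' *: y - x').
    rewrite !scalerBr !scalerDr !scalerA scalerDl opprD.
    by rewrite [X in X + _ = _]addrACA [LHS]addrACA.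
  have := ler_normD (s *: (z + b *: y - x)) (t *: (w + b' *: y - x')).
  rewrite !normrZ (ger0_norm s0) (ger0_norm t0) => /(ler_wpM2l M0).
  by lra.
have [f fl fp] := hahn_banach pl.
have fg j z : J j -> f z <= g j z.
  by move=> Jj; apply: le_trans (fp z) _; apply: ge_inf => //; exists j.
have [|h hM hf] := dual_of_linear fl M0.
  move=> x; have := fg (0, 0) x J0.
  by rewrite /g /= scale0r addr0 subr0 linear0 mul0r subr0 addr0.
have hle x : E x -> h x <= xs x.
  move=> Ex; have := fg (x, 0) x (conj Ex (lexx 0)).
  by rewrite -hf /g /= scale0r addr0 subrr normr0 mulr0 mul0r subr0 add0r.
exists h; split => //.
  move=> x Ex; apply/eqP; rewrite eq_le hle//=.
  by rewrite -lerN2; have := hle _ (EN _ Ex); rewrite !linearN.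
have := fg (0, 1) (- y) (conj E0 ler01).
rewrite -hf /g /= scale1r addNr subr0 normr0 mulr0 linear0 addr0 mul1r linearN /=.
by rewrite sub0r lerN2.
Qed.

Lemma unit_sphere_normalize x : x != 0 -> unit_sphere X (`|x|^-1 *: x).
Proof.
by move=> x0; rewrite /unit_sphere /= normrZ normfV normr_id mulVf ?normr_eq0.
Qed.

Lemma dual_norm_gt f (M : R) : nontrivial [set: X] -> M < `|f| ->
  exists2 y, unit_sphere X y & M < f y.
Proof.
move=> [w _ /unit_sphere_normalize]; set u := _ *: w => u1 Mf; apply: contrapT => nex.
have fM y : unit_sphere X y -> f y <= M.
  by move=> y1; rewrite leNgt; apply/negP => My; apply: nex; exists y.
(* The bounds at [u] and [- u] add up to [0 <= 2 * M]; this is where a unit vector is needed. *)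
have M0 : 0 <= M.
  have : f (- u) <= M by apply: fM; rewrite /unit_sphere /= normrN.
  by rewrite linearN => /(lerD (fM u u1)); rewrite subrr; lra.
suff : `|f| <= M by rewrite leNgt Mf.
have fle x : f x <= M * `|x|.
  have [->|x0] := eqVneq x 0; first by rewrite linear0 normr0 mulr0.
  have := fM _ (unit_sphere_normalize x0).
  by rewrite linearZ /= -[_ *: _]/(_ * _) ler_pdivrMl ?normr_gt0// mulrC.
apply: dual_norm_le => x x1; apply: (@le_trans _ _ (M * `|x|)); last by rewrite ler_piMr.
rewrite ler_norml fle andbT lerNl -[X in _ <= _ * X]normrN.
by apply: le_trans (fle (- x)); rewrite linearN.
Qed.

(** The zero functional on the zero subspace is extended with value at least 1 at a unit vector and
    norm at most 1. *)
Lemma unit_sphere_dual_nonempty : nontrivial [set: X] ->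
  exists f, unit_sphere (dual X) f.
Proof.
move=> [w _ /unit_sphere_normalize]; set u := _ *: w => u1.
have [|x t -> t0|f [f1 _ fu]] := @dual_extension [set 0] 0 u 1 1 _ ler01.
- split; first exact/mem_set.
  by move=> a x y /set_mem -> /set_mem ->; rewrite scaler0 addr0; exact/mem_set.
- by rewrite linear0 !add0r normrZ u1 ger0_norm// mul1r.
exists f; apply/eqP; rewrite eq_le f1/=; apply: le_trans fu _.
by apply: le_trans (ler_dual f u) _; rewrite u1 mulr1.
Qed.

End DualSpace.

(** * Basic neighbourhoods in the weak* topology *)

Section WeakStar.
Variables (R : realType) (X : normedModType R).
Implicit Types (f g : dual X).

Lemma weak_star_open_nbhs (U : set (weak_star X)) f : open U -> U f ->
  exists (s : seq X) (r : R), 0 < r /\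
    forall g, (forall x, x \in s -> `|g x - f x| < r) -> U g.
Proof.
move=> [V oV <-] Vf.
(* [F] is the filter generated by the basic neighbourhoods of [f]. Its convergence in the product
   topology is tested one coordinate at a time, where a one-point list suffices. *)
pose F : set_system {ptws X -> R^o} := [set A | exists (s : seq X) (r : R), 0 < r /\
  forall g : X -> R^o, (forall x, x \in s -> `|g x - f x| < r) -> A g].
have FF : Filter F.
  split; first by exists [::], 1.
    move=> A B [s [r [r0 sA]]] [s' [r' [r'0 sB]]].
    exists (s ++ s'), (Num.min r r'); split; first by rewrite lt_min r0.
    move=> g gf; split; [apply: sA|apply: sB] => x xs;
      by have := gf x; rewrite mem_cat xs ?orbT lt_min => /(_ isT)/andP[].
  move=> A B AB [s [r [r0 sA]]]; exists s, r; split=> // g /sA; exact: AB.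
have Ff : F --> (f : {ptws X -> R^o}).
  apply/cvg_sup => x A /= [_ [[B oB <-] Bf] BA].
  have [r r0 rB] : exists2 r : R, 0 < r & forall z : R^o, `|z - f x| < r -> B z.
    have /nbhs_ballP[r r0 rB] : nbhs (f x : R^o) B by apply: open_nbhs_nbhs.
    by exists r => // z zr; apply: rB; rewrite -ball_normE /= distrC.
  exists [:: x], r; split=> // g gf; apply: BA; apply: rB.
  by apply: gf; rewrite mem_seq1.
have [|s [r [r0 sV]]] := Ff V; first by apply: open_nbhs_nbhs.
by exists s, r; split=> // g gf; apply: sV.
Qed.

Lemma weak_star_open_basic n (x : 'I_n -> X) f (r : R) :
  open [set g : weak_star X | forall i, `|(g : dual X) (x i) - f (x i)| < r].
Proof.
rewrite openE => g /= gr.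
apply: (@filter_forall _ _ (fun i (h : weak_star X) =>
  `|(h : dual X) (x i) - f (x i)| < r) (nbhs g)) => i.
have cx : continuous (fun h : weak_star X => (h : dual X) (x i)).
  move=> h; apply: (@continuous_comp _ _ _ (fun h : weak_star X =>
    (h : dual X) : {ptws X -> R^o}) (fun h => h (x i))).
    exact: initial_continuous.
  exact: proj_continuous.
have : open [set z : R^o | `|z - f (x i)| < r].
  have -> : [set z : R^o | `|z - f (x i)| < r] = ball (f (x i) : R^o) r.
    by apply/seteqP; split=> z; rewrite -ball_normE /= distrC.
  exact: ball_open.
by move=> oB; exact: (cx g _ (open_nbhs_nbhs (conj oB (gr i)))).
Qed.

End WeakStar.

(** * Finite nets in finite-dimensional spheres *)

Section FiniteDimensional.
Variables (R : realType) (X : normedModType R).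
Implicit Types (E : set X).

(** A spanning family of least size is free, because a nontrivial relation would express one vector
    by the others. Nontriviality makes the size a successor. *)
Lemma finite_dimensional_basis E : finite_dimensional E -> nontrivial E ->
  exists (n : nat) (e : 'I_n.+1 -> X), [/\ forall i, E (e i),
    forall x, E x -> exists a : 'I_n.+1 -> R, x = \sum_i a i *: e i &
    forall a : 'I_n.+1 -> R, \sum_i a i *: e i = 0 -> forall i, a i = 0].
Proof.
move=> fE [w Ew w0].
pose P m := `[< exists e : 'I_m -> X, (forall i, E (e i)) /\
  forall x, E x -> exists a : 'I_m -> R, x = \sum_i a i *: e i >].
have exP : exists m, P m by have [m me] := fE; exists m; apply/asboolP.
case: (ex_minnP exP) => -[|n] /asboolP[e [Ee Espan]] emin.
  by have [a wa] := Espan w Ew; rewrite wa big_ord0 eqxx in w0.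
exists n, e; split=> // a a0 k; apply: contrapT => /eqP ak.
suff /emin : P n by rewrite ltnn.
apply/asboolP; exists (e \o lift k); split=> [i|x Ex]; first exact: Ee.
have [b ->] := Espan x Ex.
exists (fun i => b (lift k i) - b k / a k * a (lift k i)).
have ek : e k = - \sum_i (a (lift k i) / a k) *: e (lift k i).
  move: a0; rewrite (bigD1_ord k)//= => /(congr1 ( *:%R (a k)^-1)).
  rewrite scalerDr scalerA mulVf// scale1r scaler0 => /eqP.
  rewrite addr_eq0 => /eqP ->; congr (- _); rewrite scaler_sumr.
  by apply: eq_bigr => i _; rewrite scalerA mulrC.
rewrite (bigD1_ord k)//= ek scalerN scaler_sumr addrC -sumrB.
apply: eq_bigr => i _; rewrite scalerA scalerBl; congr (_ - _ *: _).
by rewrite mulrA mulrAC.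
Qed.

(** The sphere is the image, under the coordinate map [T], of a closed set of coordinates. That set
    is bounded because the norm of [T a] dominates a positive multiple of the norm of [a], the
    factor being the minimum over the coordinate sphere. *)
Lemma compact_unit_sphere E : linear_subspace E -> finite_dimensional E ->
  nontrivial E -> compact (E `&` unit_sphere X).
Proof.
move=> Esub fE ntE; have [n [e [Ee Espan efree]]] := finite_dimensional_basis fE ntE.
pose T (a : 'rV[R]_n.+1) : X := \sum_i a 0 i *: e i.
have Tc : continuous T.
  apply: continuous_big => [|i _ a]; first exact: add_continuous.
  by apply: continuousZr_tmp; exact: coord_continuous.
have normTc : continuous (fun a => `|T a|).
  by move=> a; apply: continuous_comp; [exact: Tc|exact: norm_continuous].
have TZ t a : T (t *: a) = t *: T a.
  by rewrite /T scaler_sumr; apply: eq_bigr => i _; rewrite mxE scalerA.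
have ET a : E (T a).
  apply: big_ind => [|x y Ex Ey|i _]; first by case: Esub => /set_mem.
    by rewrite -[x]scale1r -[y]scale1r; exact: linear_subspaceD.
  by rewrite -[_ *: _]addr0 -(scale0r (e i)); exact: linear_subspaceD.
have T0 a : T a = 0 -> a = 0.
  by move=> /efree a0; apply/rowP => i; rewrite a0 mxE.
have level (f : 'rV[R]_n.+1 -> R) : continuous f -> closed [set a | f a = 1].
  move=> fc; apply: (@preimage_closed _ _ f [set x | x = 1]); last exact: closed_eq.
  by move=> a _; exact: fc.
have Scompact : compact [set a : 'rV[R]_n.+1 | `|a| = 1].
  apply: bounded_closed_compact; last exact/level/norm_continuous.
  by exists 1; split => // M M1 a /= ->; exact: ltW.
have S0 : [set a : 'rV[R]_n.+1 | `|a| = 1] !=set0.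
  have d0 : delta_mx 0 0 != 0 :> 'rV[R]_n.+1.
    by apply/eqP => /rowP/(_ 0)/eqP; rewrite !mxE eqxx oner_eq0.
  exists (`|delta_mx 0 0 : 'rV[R]_n.+1|^-1 *: delta_mx 0 0) => /=.
  by rewrite normrZ normfV normr_id mulVf ?normr_eq0.
have [c /set_mem c1 cmin] :=
  compact_EVT_min S0 Scompact (continuous_subspaceT normTc).
have Tc0 : 0 < `|T c|.
  rewrite normr_gt0; apply/eqP => /T0 c0.
  by move: c1; rewrite c0 /= normr0 => /esym/eqP; rewrite oner_eq0.
have Tle a : `|T c| * `|a| <= `|T a|.
  have [->|a0] := eqVneq a 0; first by rewrite normr0 mulr0.
  have /mem_set/cmin : `| `|a|^-1 *: a| = 1.
    by rewrite normrZ normfV normr_id mulVf ?normr_eq0.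
  by rewrite TZ normrZ normfV normr_id mulrC ler_pdivlMr ?normr_gt0.
have -> : E `&` unit_sphere X = T @` [set a | `|T a| = 1].
  apply/seteqP; split=> [x [Ex x1]|_ [a a1 <-]]; last by split.
  have [a xa] := Espan x Ex; exists (\row_i a i).
    rewrite /= -[RHS]x1 xa; congr (`| _ |).
    by apply: eq_bigr => i _; rewrite mxE.
  by rewrite xa; apply: eq_bigr => i _; rewrite mxE.
apply: continuous_compact; first exact: continuous_subspaceT.
apply: bounded_closed_compact; last exact: level.
exists `|T c|^-1; split => // M M1 a /= a1; apply: le_trans (ltW M1).
by rewrite -[leRHS]mulr1 ler_pdivlMl// -a1.
Qed.

Lemma finite_net_unit_sphere E (r : R) : linear_subspace E ->
    finite_dimensional E -> nontrivial E -> 0 < r ->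
  exists (n : nat) (x : 'I_n -> X), [/\ (0 < n)%N,
    forall i, (E `&` unit_sphere X) (x i) &
    forall z, (E `&` unit_sphere X) z -> exists i, `|z - x i| < r].
Proof.
move=> Esub fE ntE r0.
have := compact_unit_sphere Esub fE ntE; rewrite compact_cover.
move=> /(_ X (E `&` unit_sphere X) (fun x => ball x r)).
case=> [x _|z Sz|D DS Dcov]; first exact: ball_open.
  by exists z => //; exact: ballxx.
pose s := finmap.enum_fset D.
have net z : (E `&` unit_sphere X) z ->
    exists i : 'I_(size s), `|z - tnth (in_tuple s) i| < r.
  move=> /Dcov[x /= xD]; rewrite -ball_normE /= distrC => zx.
  have xD' : (index x s < size s)%N by rewrite index_mem.
  by exists (Ordinal xD'); rewrite (tnth_nth x) /= nth_index.
exists (size s), (tnth (in_tuple s)); split => //.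
  have [w Ew w0] := ntE.
  have /net[i _] : (E `&` unit_sphere X) (`|w|^-1 *: w).
    split; last exact: unit_sphere_normalize.
    by rewrite -[_ *: _]addr0 -(scale0r w); exact: linear_subspaceD.
  exact: leq_ltn_trans (leq0n i) (ltn_ord i).
by move=> i; apply/set_mem/DS; exact: mem_tnth.
Qed.

End FiniteDimensional.

(** * Infima of slopes *)

Section Slopes.
Variables (R : realType) (X : normedModType R).
Variables (I : Type) (J : set I) (x : I -> X) (xs : dual X) (t0 : R).
Hypotheses (J0 : J !=set0) (x1 : forall i, J i -> unit_sphere X (x i)).
Hypotheses (xs1 : unit_ball (dual X) xs) (t0_gt0 : 0 < t0).

Definition slope_inf y := inf [set (`|x i + t *: y| - xs (x i)) / t
  | i in J & t in [set t : R | t0 <= t]].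

(** This turns the difference of infimum and supremum in the theorem into
    [slope_inf y + slope_inf (- y)], so that only infima need estimates. *)
Lemma sup_slope y : sup [set (`|x i - t *: y| - xs (x i)) / - t
  | i in J & t in [set t : R | t0 <= t]] = - slope_inf (- y).
Proof.
rewrite /slope_inf /inf opprK; congr sup; apply/seteqP; split=> r.
  move=> [i Ji [t tt0 <-]]; exists ((`|x i + t *: - y| - xs (x i)) / t).
    by exists i => //; exists t.
  by rewrite scalerN invrN mulrN.
move=> [_ [i Ji [t tt0 <-]] <-]; exists i => //; exists t => //.
by rewrite scalerN invrN mulrN.
Qed.

Lemma le_slope_inf y a :
  (forall i t, J i -> t0 <= t -> t * a <= `|x i + t *: y| - xs (x i)) ->
  a <= slope_inf y.
Proof.
move=> ay; apply: lb_le_inf.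
  have [i Ji] := J0; exists ((`|x i + t0 *: y| - xs (x i)) / t0), i => //.
  by exists t0; first exact: lexx.
move=> _ [i Ji [t tt0 <-]]; rewrite ler_pdivlMr ?(lt_le_trans t0_gt0)// mulrC.
exact: ay.
Qed.

Lemma slope_inf_le y i t : unit_sphere X y -> J i -> t0 <= t ->
  t * slope_inf y <= `|x i + t *: y| - xs (x i).
Proof.
move=> y1 Ji tt0; have tp := lt_le_trans t0_gt0 tt0.
rewrite mulrC -ler_pdivlMr//; apply: ge_inf; last by exists i => //; exists t.
(* The norm of [x j + s *: y] is at least [s - 1] and [xs (x j) <= 1], so the slope at [s] is at
   least [1 - 2 / s]. *)
exists (1 - 2 / t0) => _ [j Jj [s /= st0 <-]]; have sp := lt_le_trans t0_gt0 st0.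
have : `|s *: y| <= `|x j + s *: y| + `|x j|.
  by apply: le_trans (ler_normB _ _); rewrite addrC addKr.
have := ler_unit_ball (x j) xs1.
rewrite x1// normrZ y1 mulr1 gtr0_norm// => xsj sle.
apply: (@le_trans _ _ (1 - 2 / s)).
  by rewrite lerD2l lerN2 ler_pM2l// lef_pV2.
by rewrite ler_pdivlMr// mulrBl divfK ?gt_eqF//; lra.
Qed.

Lemma slope_inf_le1 y : unit_sphere X y -> slope_inf y <= 1.
Proof.
move=> y1; have [i Ji] := J0; rewrite leNgt; apply/negP => a1.
(* The triangle inequality gives [t * (a - 1) <= 2], which this [t] contradicts by making the
   product at least 3. *)
pose a := slope_inf y; pose t := Num.max t0 (3 / (a - 1)).
have := @slope_inf_le y i t y1 Ji; rewrite -/a le_max lexx => /(_ isT).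
have tp : 0 < t by rewrite lt_max t0_gt0.
have := ler_normD (x i) (t *: y); rewrite normrZ y1 mulr1 gtr0_norm// x1//.
have := ler_unit_ball (- x i) xs1; rewrite normrN x1// linearN /=.
have : 3 <= t * (a - 1).
  by rewrite -ler_pdivrMr ?subr_gt0// le_max lexx orbT.
rewrite mulrBr mulr1; move: (t * a) => ta; lra.
Qed.

End Slopes.

(** * From roughness to slopes, and from slopes to extensions *)

Section Implications.
Variables (R : realType) (X : normedModType R).
Hypothesis ntX : nontrivial [set: X].
Implicit Types (xs : dual X) (E : set X) (delta : R).

Lemma rough_separation delta n (x : 'I_n -> X) xs (e : R) :
  weakly_average_rough X delta -> unit_ball (dual X) xs -> 0 < e ->
  exists (f1 f2 : dual X) (y : X),
    [/\ unit_ball (dual X) f1 /\ unit_ball (dual X) f2, unit_sphere X y,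
      forall i, `|f1 (x i) - xs (x i)| < e /\ `|f2 (x i) - xs (x i)| < e &
      delta - e < f1 y - f2 y].
Proof.
move=> rough xs1 e0.
pose U := [set g : weak_star X | forall i, `|(g : dual X) (x i) - xs (x i)| < e].
pose A : set (dual X) := U `&` unit_ball (dual X).
have diamA : (delta%:E <= diameter A)%E.
  apply: rough; first by exists U => //; exact: weak_star_open_basic.
  by exists xs; split => // i; rewrite subrr normr0.
have /ereal_sup_gt : ((delta - e)%:E < diameter A)%E.
  by apply: lt_le_trans diamA; rewrite lte_fin ltrBlDr ltrDl.
move=> [_ [[f1 f2] [/= [Uf1 f11] [Uf2 f21]] <-]]; rewrite lte_fin.
move=> /(dual_norm_gt ntX)[y y1 fy]; by exists f1, f2, y; split.
Qed.

Lemma slope_inf_separation delta n (x : 'I_n -> X) xs (e t0 : R) :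
    weakly_average_rough X delta -> (0 < n)%N -> unit_ball (dual X) xs ->
    0 < e -> 0 < t0 ->
  exists2 y, unit_sphere X y &
    delta - e < slope_inf setT x xs t0 y + slope_inf setT x xs t0 (- y).
Proof.
move=> rough n0 xs1 e0 t00.
(* The separation loses at most [e / 2]. Each slope loses [r / t <= e / 4] for [t >= t0], so the
   total loss is at most [e]. *)
pose r := Num.min (e / 2) (e * t0 / 4).
have r0 : 0 < r by rewrite lt_min !divr_gt0// mulr_gt0.
have [f1 [f2 [y [[f11 f21] y1 fx fy]]]] := rough_separation x rough xs1 r0.
have low (f : dual X) z : unit_ball (dual X) f ->
    (forall i, `|f (x i) - xs (x i)| < r) ->
    f z - e / 4 <= slope_inf setT x xs t0 z.
  move=> f1' fxs; apply: le_slope_inf => //; first by exists (Ordinal n0).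
  move=> i t _ tt0; have := ler_unit_ball (x i + t *: z) f1'.
  have fl : f (x i + t *: z) = f (x i) + t * f z by rewrite linearD linearZ.
  rewrite fl; have := fxs i; rewrite ltr_norml => /andP[+ _].
  have : r <= t * (e / 4).
    by rewrite /r ge_min; apply/orP; right; nra.
  rewrite mulrBr; move: (t * f z) => tfz; lra.
exists y => //.
have l1 : f1 y - e / 4 <= slope_inf setT x xs t0 y by apply: low => // i; case: (fx i).
have : f2 (- y) - e / 4 <= slope_inf setT x xs t0 (- y).
  by apply: low => // i; case: (fx i).
have : r <= e / 2 by rewrite /r ge_min lexx.
rewrite linearN /=; move: fy l1; move: (f1 y) (f2 y) => a b; lra.
Qed.

(** Replacing [z] by a net point changes the norm and the value of [xs] by at most [r] each, and the
    quotient has denominator at least [t0]. *)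
Lemma slope_inf_net E n (x : 'I_n -> X) xs (r t0 : R) y :
    E `&` unit_sphere X !=set0 -> (forall i, unit_sphere X (x i)) ->
    (forall z, (E `&` unit_sphere X) z -> exists i, `|z - x i| < r) ->
    unit_ball (dual X) xs -> 0 < t0 -> unit_sphere X y ->
  slope_inf setT x xs t0 y - 2 * r / t0
    <= slope_inf (E `&` unit_sphere X) id xs t0 y.
Proof.
move=> E0 x1 net xs1 t00 y1; apply: le_slope_inf => // z t Ez tt0.
have [i zx] := net _ Ez.
have := slope_inf_le (J := setT) (fun i _ => x1 i) xs1 t00 y1 I tt0 (i := i).
have : `|x i + t *: y| <= `|z + t *: y| + `|z - x i|.
  suff {1}-> : x i + t *: y = z + t *: y - (z - x i) by exact: ler_normB.
  by rewrite opprB [RHS]addrC addrA subrK.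
have := ler_unit_ball (z - x i) xs1; rewrite linearB /=.
have : 2 * r <= t * (2 * r / t0).
  have r0 : 0 < r by apply: le_lt_trans zx.
  by rewrite mulrCA ler_peMr ?mulr_ge0 ?(ltW r0)// ler_pdivlMr// mul1r.
rewrite mulrBr; move: (t * slope_inf _ _ _ _ _) (xs z) (xs (x i)) => a b c; lra.
Qed.

Lemma slope_inf_functional E xs (e : R) y : linear_subspace E -> nontrivial E ->
    unit_ball (dual X) xs -> 0 < e -> unit_sphere X y ->
  exists f : dual X, [/\ `|f| <= 1 + e, forall x, E x -> f x = xs x &
    slope_inf (E `&` unit_sphere X) id xs (e / (2 + e)) y <= f y].
Proof.
move=> Esub [w Ew w0] xs1 e0 y1; set t0 := e / _; set a := slope_inf _ _ _ _ _.
have t00 : 0 < t0 by rewrite divr_gt0// addr_gt0.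
have Enormalize z : E z -> z != 0 -> (E `&` unit_sphere X) (`|z|^-1 *: z).
  move=> Ez z0; split; last exact: unit_sphere_normalize.
  by rewrite -[_ *: _]addr0 -(scale0r z); exact: linear_subspaceD.
have S0 : E `&` unit_sphere X !=set0 by exists (`|w|^-1 *: w); exact: Enormalize.
have S1 z : (E `&` unit_sphere X) z -> unit_sphere X (id z) by case.
have a1 : a <= 1 by exact: slope_inf_le1.
apply: dual_extension => // [|x t Ex tge0]; first by rewrite addr_ge0// ltW.
have [->|x0] := eqVneq x 0.
  rewrite linear0 !add0r normrZ y1 mulr1 ger0_norm//; nra.
have xp : 0 < `|x| by rewrite normr_gt0.
(* When [t] is large, dividing by the norm of [x] reduces the domination to the definition of [a] on
   the sphere. *)
have [far|near] := leP (t0 * `|x|) t.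
  have tx : t0 <= t / `|x| by rewrite ler_pdivlMr.
  have := slope_inf_le S1 xs1 t00 y1 (Enormalize _ Ex x0) tx.
  have -> : `|x|^-1 *: x + (t / `|x|) *: y = `|x|^-1 *: (x + t *: y).
    by rewrite scalerDr scalerA mulrC.
  have xsZ : xs (`|x|^-1 *: x) = `|x|^-1 * xs x by rewrite linearZ.
  rewrite -/a /= xsZ normrZ normfV normr_id.
  rewrite -mulrBr ler_pdivlMl// mulrA mulrCA divff ?gt_eqF// mulr1 => h.
  have : `|x + t *: y| <= (1 + e) * `|x + t *: y| by rewrite ler_peMl ?lerDl ?(ltW e0).
  move: (xs x) (t * a) h => b c; lra.
(* When [t] is small, write [N] for the norm of [x]. It suffices that [N + t <= (1 + e) * (N - t)],
   that is [t * (2 + e) <= e * N]; hence the threshold [e / (2 + e)]. *)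
have := ler_unit_ball x xs1.
have : `|x| <= `|x + t *: y| + t.
  have := ler_normB (x + t *: y) (t *: y).
  by rewrite addrK normrZ y1 mulr1 ger0_norm.
have : t * (2 + e) <= e * `|x|.
  by rewrite -ler_pdivlMr ?addr_gt0// mulrAC ltW.
have : t * a <= t by rewrite ler_piMr.
move: (xs x) (t * a) => b c; nra.
Qed.

End Implications.

(** * From separation on the sphere to roughness *)

Section Roughness.
Variables (R : realType) (X : normedModType R).
Hypothesis ntX : nontrivial [set: X].
Implicit Types (xs : dual X) (E : set X) (delta : R).

(** This is assertion (v), stated exactly as in the theorem. *)
Definition sphere_separation delta :=
  forall (n : nat) (x : 'I_n -> X) (xs : dual X) (e : R),
    (0 < n)%N -> (forall i, unit_sphere X (x i)) ->
    unit_sphere (dual X) xs -> 0 < e ->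
    exists (xs1 xs2 : dual X) (y : X),
      [/\ unit_ball (dual X) xs1 /\ unit_ball (dual X) xs2,
          unit_ball X y,
          forall i, `|xs1 (x i) - xs (x i)| < e
                 /\ `|xs2 (x i) - xs (x i)| < e &
          xs1 y - xs2 y > delta - e].

Definition linear_span n (x : 'I_n -> X) : set X :=
  [set z | exists a : 'I_n -> R, z = \sum_i a i *: x i].

Lemma linear_span_subspace n (x : 'I_n -> X) : linear_subspace (linear_span x).
Proof.
split; first by apply/mem_set; exists (fun=> 0); rewrite big1// => i _; rewrite scale0r.
move=> c u v /set_mem[a ->] /set_mem[b ->]; apply/mem_set.
exists (fun i => c * a i + b i); rewrite scaler_sumr -big_split /=.
by apply: eq_bigr => i _; rewrite scalerA scalerDl.
Qed.

Lemma linear_span_mem n (x : 'I_n -> X) i : linear_span x (x i).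
Proof.
exists (fun j => (j == i)%:R); rewrite (bigD1 i)//= eqxx scale1r big1 ?addr0//.
by move=> j /negbTE ->; rewrite scale0r.
Qed.

(** The extensions from the span of the given points are scaled into the unit ball, which spoils
    both the agreement and the separation only slightly. *)
Lemma sphere_separation_of_extension delta : 0 < delta ->
  (forall (E : set X) (xs : dual X) (e : R),
     linear_subspace E -> finite_dimensional E -> nontrivial E ->
     unit_ball (dual X) xs -> 0 < e ->
     exists (xs1 xs2 : dual X) (y : X),
       [/\ `|xs1| <= 1 + e /\ `|xs2| <= 1 + e,
           unit_sphere X y,
           forall x, E x -> xs1 x = xs x /\ xs2 x = xs x &
           xs1 y - xs2 y > delta - e]) ->
  sphere_separation delta.
Proof.
move=> d0 ext n x xs e n0 x1 xs1 e0.
(* Scaling by [k = (1 + t)^-1] moves the values by at most [1 - k < t], and [k * (delta - t) >=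
   delta - t * (1 + delta) = delta - e / 2]. *)
pose t := e / (2 * (1 + delta)).
have td : t * (2 * (1 + delta)) = e by rewrite divfK// gt_eqF// mulr_gt0// addr_gt0.
have t0 : 0 < t by rewrite divr_gt0// mulr_gt0// addr_gt0.
have t1 : 0 < 1 + t by rewrite addr_gt0.
have ntE : nontrivial (linear_span x).
  exists (x (Ordinal n0)); first exact: linear_span_mem.
  by rewrite -normr_eq0 x1 oner_eq0.
have finE : finite_dimensional (linear_span x).
  by exists n, x; split=> // i; exact: linear_span_mem.
have [|f1 [f2 [y [[f11 f21] y1 fE fy]]]] :=
  ext _ xs t (linear_span_subspace x) finE ntE _ t0; first by rewrite /unit_ball /= xs1.
pose k := (1 + t)^-1.
have k0 : 0 < k by rewrite invr_gt0.
have kt : k * (1 + t) = 1 by rewrite mulVf// gt_eqF.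
have scaled (f : dual X) : `|f| <= 1 + t -> unit_ball (dual X) (k *: f).
  by move=> f1'; rewrite /unit_ball /= normrZ (gtr0_norm k0) -kt ler_pM2l.
have near (f : dual X) i : f (x i) = xs (x i) -> `|(k *: f) (x i) - xs (x i)| < e.
  move=> fx; have -> : (k *: f) (x i) - xs (x i) = (k - 1) * xs (x i).
    by rewrite mulrBl mul1r -fx.
  have xsx : `|xs (x i)| <= 1.
    by apply: le_trans (ler_dual_norm xs _) _; rewrite -[dual_norm xs]/(`|xs|) xs1 x1 mulr1.
  rewrite normrM; apply: (@le_lt_trans _ _ `|k - 1|); first by rewrite ler_piMr.
  rewrite ltr_norml; apply/andP; split; nra.
exists (k *: f1), (k *: f2), y; split.
- by split; exact: scaled.
- by rewrite /unit_ball /= y1.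
- by move=> i; have [? ?] := fE _ (linear_span_mem x i); split; exact: near.
have -> : (k *: f1) y - (k *: f2) y = k * (f1 y - f2 y) by rewrite mulrBr.
move: fy; move: (f1 y - f2 y) => a fy.
have : k * (delta - t) < k * a by rewrite ltr_pM2l.
nra.
Qed.

(** Weak* neighbourhoods involve arbitrary vectors, so these are normalised and the tolerance is
    divided by [1 + M], where [M] bounds their norms. *)
Lemma sphere_separation_seq delta (s : seq X) xs (e : R) :
  sphere_separation delta -> unit_sphere (dual X) xs -> 0 < e ->
  exists (f1 f2 : dual X) (y : X),
    [/\ unit_ball (dual X) f1 /\ unit_ball (dual X) f2, unit_ball X y,
      forall z, z \in s -> `|f1 z - xs z| < e /\ `|f2 z - xs z| < e &
      delta - e < f1 y - f2 y].
Proof.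
move=> sep xs1 e0; have [w _ w0] := ntX.
pose u z : X := if z == 0 then `|w|^-1 *: w else `|z|^-1 *: z.
have u1 z : unit_sphere X (u z).
  by rewrite /u; case: ifPn => [_|]; exact: unit_sphere_normalize.
have uE z : z = `|z| *: u z.
  rewrite /u; case: eqP => [->|/eqP z0]; first by rewrite normr0 scale0r.
  by rewrite scalerA mulfV ?normr_eq0// scale1r.
pose M := \sum_(z <- s) `|z|.
have M0 : 0 <= M by apply: sumr_ge0.
have sM z : z \in s -> `|z| <= M.
  by move=> zs; rewrite /M (big_rem z)//= lerDl; apply: sumr_ge0.
pose r := e / (1 + M).
have M1 : 0 < 1 + M by rewrite ltr_wpDr.
have r0 : 0 < r by rewrite divr_gt0.
have rM : r * (1 + M) = e by rewrite divfK// gt_eqF.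
(* Prepending [w] keeps the family nonempty even when [s] is empty. *)
have [//|f1 [f2 [y [fb y1 fx fy]]]] :=
  sep _ (fun i => u (tnth (in_tuple (w :: s)) i)) xs r isT _ xs1 r0.
have close (f : dual X) z : `|f (u z) - xs (u z)| < r -> z \in s ->
    `|f z - xs z| < e.
  have linu (h : dual X) : h z = `|z| * h (u z) by rewrite {1}[z]uE linearZ.
  move=> fr zs; rewrite (linu f) (linu xs) -mulrBr.
  rewrite normrM normr_id; have := sM z zs; have := normr_ge0 z.
  move: (normr_ge0 (f (u z) - xs (u z))) fr; move: `|_ - _| `|z| => a b; nra.
exists f1, f2, y; split=> //; last by apply: le_lt_trans fy; nra.
move=> z zs; have zi : (index z (w :: s) < size (w :: s))%N.
  by rewrite index_mem inE zs orbT.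
have := fx (Ordinal zi); rewrite (tnth_nth w) /= nth_index ?inE ?zs ?orbT// => -[fz1 fz2].
by split; exact: close.
Qed.

(** Intermediate value theorem: the norm of [f + t *: u] is at most 1 at [t = 0] and at least
    [2 - 1] at the right end. *)
Lemma unit_sphere_translate (Z : normedModType R) (f u : Z) :
  unit_ball Z f -> u != 0 ->
  exists t : R, 0 <= t <= 2 / `|u| /\ unit_sphere Z (f + t *: u).
Proof.
move=> f1 u0; have up : 0 < `|u| by rewrite normr_gt0.
have b0 : 0 <= 2 / `|u| by rewrite divr_ge0.
pose h (t : R) := `|f + t *: u|.
have hc : continuous h.
  have uc : continuous (fun t : R => t *: u) by move=> t; exact: cvgZr_tmp.
  move=> t; have ct := continuousD (@cst_continuous _ _ f t) (uc t).
  by apply: (continuous_comp ct); exact: norm_continuous.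
have [||c cb hc1] := @IVT R h 0 (2 / `|u|) 1 b0.
- exact: continuous_subspaceT.
- rewrite ge_min le_max; apply/andP; split; apply/orP; [left|right].
    by rewrite /h scale0r addr0.
  have := ler_normB (f + (2 / `|u|) *: u) f.
  rewrite addrAC subrr add0r normrZ ger0_norm// divfK ?gt_eqF// /h.
  by move: f1; rewrite /unit_ball /=; lra.
by exists c; split=> //; move: cb; rewrite in_itv.
Qed.

(* The difference of two separated functionals almost vanishes at the given
   points but has norm at least [delta / 2], so a bounded multiple of it moves
   any functional of the ball to the sphere inside the given neighbourhood. *)
Lemma rough_of_sphere_separation delta : 0 < delta ->
  sphere_separation delta -> weakly_average_rough X delta.
Proof.
move=> d0 sep A [U oU ->] [f0 [Uf0 f01]].
have [s [r [r0 sU]]] := weak_star_open_nbhs oU Uf0.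
(* Any functional of norm one will do as [v], since it cancels in the estimate of [f1 - f2]. *)
have [v v1] := unit_sphere_dual_nonempty ntX.
(* The first bound gives [u] norm at least [delta / 2], whence [t <= 4 / delta]. The second then
   makes [t * u z] at most [4 / delta * (2 * e1) <= r / 2] in absolute value on [s]. *)
pose e1 := Num.min (delta / 2) (r * delta / 16).
have e10 : 0 < e1 by rewrite lt_min !divr_gt0// mulr_gt0.
have e1d : e1 <= delta / 2 by rewrite ge_min lexx.
have e1r : e1 <= r * delta / 16 by rewrite ge_min lexx orbT.
have [f1 [f2 [y [_ y1 fs fy]]]] := sphere_separation_seq s sep v1 e10.
pose u := f1 - f2.
have unorm : delta / 2 <= `|u|.
  have : u y <= `|u| by apply: le_trans (ler_dual u y) _; rewrite ler_piMr.
  rewrite /u dual_subE; move: fy; move: (f1 y) (f2 y) => a b; lra.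
have us z : z \in s -> `|u z| <= 2 * e1.
  move=> /fs[h1 h2]; rewrite /u dual_subE.
  have -> : f1 z - f2 z = (f1 z - v z) - (f2 z - v z) by rewrite opprB addrA subrK.
  by apply: le_trans (ler_normB _ _) _; lra.
have u0 : u != 0 by rewrite -normr_gt0; lra.
have [t [/andP[t0 tu] ft1]] := unit_sphere_translate f01 u0.
have td : t * delta <= 4.
  have := tu; rewrite ler_pdivlMr ?normr_gt0//; nra.
apply/lee_addgt0Pr => e e0.
(* The second separation takes place at the functional pushed to the sphere; half of [r] is left for
   it. *)
have [|g1 [g2 [z [[g11 g21] z1 gs gz]]]] :=
  @sphere_separation_seq delta s _ (Num.min e (r / 2)) sep ft1.
  by rewrite lt_min e0 divr_gt0.
have close (g : dual X) : (forall z, z \in s ->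
    `|g z - (f0 + t *: u) z| < Num.min e (r / 2)) -> U g.
  move=> gfu; apply: sU => x xs; have := gfu x xs; rewrite lt_min => /andP[_].
  have -> : g x - f0 x = (g x - (f0 + t *: u) x) + t * u x.
    by rewrite -[(f0 + t *: u) x]/(f0 x + t * u x) opprD addrA subrK.
  have : `|t * u x| <= r / 2.
    rewrite normrM ger0_norm//; have := us x xs.
    have := normr_ge0 (u x); move: `|u x| => a; nra.
  have := ler_normD (g x - (f0 + t *: u) x) (t * u x); lra.
rewrite -leeBlDr// -EFinB; apply: (@le_trans _ _ `|g1 - g2|%:E).
  rewrite lee_fin; apply: (@le_trans _ _ ((g1 - g2) z)).
    by apply: le_trans (ltW gz); rewrite lerD2l lerN2 ge_min lexx.
  by apply: le_trans (ler_dual _ z) _; rewrite ler_piMr.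
apply: ereal_sup_ubound; exists (g1, g2) => //=.
by split; split => //; apply: close => x /gs[].
Qed.

End Roughness.

Theorem theorem3p3 (R : realType) (X : completeNormedModType R) (delta : R)
    (ntX : nontrivial [set: X]) (delta_gt0 : 0 < delta) :
  [<-> weakly_average_rough X delta;
       forall (n : nat) (x : 'I_n -> X) (xs : dual X) (e t0 : R),
         (0 < n)%N -> (forall i, unit_sphere X (x i)) ->
         unit_ball (dual X) xs -> 0 < e -> 0 < t0 ->
         exists2 y : X, unit_sphere X y &
           inf [set (`|x i + t *: y| - xs (x i)) / t
                 | i in [set: 'I_n] & t in [set t : R | t0 <= t]]
           - sup [set (`|x i - t *: y| - xs (x i)) / - t
                 | i in [set: 'I_n] & t in [set t : R | t0 <= t]]
           > delta - e;
       forall (E : set X) (xs : dual X) (e t0 : R),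
         linear_subspace E -> finite_dimensional E -> nontrivial E ->
         unit_ball (dual X) xs -> 0 < e -> 0 < t0 ->
         exists2 y : X, unit_sphere X y &
           inf [set (`|x + t *: y| - xs x) / t
                 | x in E `&` unit_sphere X & t in [set t : R | t0 <= t]]
           - sup [set (`|x - t *: y| - xs x) / - t
                 | x in E `&` unit_sphere X & t in [set t : R | t0 <= t]]
           > delta - e;
       forall (E : set X) (xs : dual X) (e : R),
         linear_subspace E -> finite_dimensional E -> nontrivial E ->
         unit_ball (dual X) xs -> 0 < e ->
         exists (xs1 xs2 : dual X) (y : X),
           [/\ `|xs1| <= 1 + e /\ `|xs2| <= 1 + e,
               unit_sphere X y,
               forall x, E x -> xs1 x = xs x /\ xs2 x = xs x &
               xs1 y - xs2 y > delta - e];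
       forall (n : nat) (x : 'I_n -> X) (xs : dual X) (e : R),
         (0 < n)%N -> (forall i, unit_sphere X (x i)) ->
         unit_sphere (dual X) xs -> 0 < e ->
         exists (xs1 xs2 : dual X) (y : X),
           [/\ unit_ball (dual X) xs1 /\ unit_ball (dual X) xs2,
               unit_ball X y,
               forall i, `|xs1 (x i) - xs (x i)| < e
                      /\ `|xs2 (x i) - xs (x i)| < e &
               xs1 y - xs2 y > delta - e]
  ].
Proof.
tfae.
- move=> rough n x xs e t0 n0 x1 xs1 e0 t00.
  have [y y1 ys] := slope_inf_separation ntX x rough n0 xs1 e0 t00.
  by exists y => //; rewrite (sup_slope [set: 'I_n] x) opprK.
- move=> slope E xs e t0 Esub finE ntE xs1 e0 t00.
  (* A net of this mesh costs [e / 4] for each of [y] and [- y]; the other [e / 2] is spent on the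
     net points. *)
  have r0 : 0 < e * t0 / 8 by rewrite divr_gt0// mulr_gt0.
  have [n [x [n0 xE net]]] := finite_net_unit_sphere Esub finE ntE r0.
  have x1 i : unit_sphere X (x i) by case: (xE i).
  have S0 : E `&` unit_sphere X !=set0 by exists (x (Ordinal n0)).
  have [|y y1] := slope n x xs (e / 2) t0 n0 x1 xs1 _ t00; first by rewrite divr_gt0.
  rewrite (sup_slope [set: 'I_n] x) opprK => ys.
  exists y => //; rewrite (sup_slope (E `&` unit_sphere X) id) opprK.
  have Ny1 : unit_sphere X (- y) by rewrite /unit_sphere /= normrN.
  have := slope_inf_net S0 x1 net xs1 t00 Ny1.
  have := slope_inf_net S0 x1 net xs1 t00 y1.
  have -> : 2 * (e * t0 / 8) / t0 = e / 4 by field; rewrite gt_eqF.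
  move: ys; lra.
- move=> slope E xs e Esub finE ntE xs1 e0.
  have t00 : 0 < e / (2 + e) by rewrite divr_gt0// addr_gt0.
  have [y y1] := slope E xs e _ Esub finE ntE xs1 e0 t00.
  rewrite (sup_slope (E `&` unit_sphere X) id) opprK => ys.
  have Ny1 : unit_sphere X (- y) by rewrite /unit_sphere /= normrN.
  have [f1 [f1n f1E f1y]] := slope_inf_functional Esub ntE xs1 e0 y1.
  have [f2 [f2n f2E]] := slope_inf_functional Esub ntE xs1 e0 Ny1.
  rewrite linearN /= => f2y.
  exists f1, f2, y; split=> // [x Ex|]; first by rewrite f1E ?f2E.
  apply: lt_le_trans ys _; exact: lerD.
- exact: sphere_separation_of_extension.
- exact: rough_of_sphere_separation.
Qed.
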